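(* Let $U=(U_{i,j})_{i,j\ge 0}$ be the infinite integer matrix, with rows and columns indexed by non-negative integers, defined by $U_{i,j}=1$ if the binomial coefficient $\binom{j}{i}$ is odd and $U_{i,j}=0$ if it is even (with $\binom{j}{i}=0$ for $i>j$). For integers $n,m\ge 0$ let $U_m(n)=U_{[0:n),[m:m+n)}$ denote the $n\times n$ sub-matrix of $U$ formed by the rows indexed $0,1,\dots,n-1$ and the columns indexed $m,m+1,\dots,m+n-1$. Then for all $n,m\ge 0$, the determinant of $U_m(n)$, computed in $\mathbb{Z}$, equals $1$ or $-1$.
   Context: For integers $a\le b$, $[a:b)=\{k\in\mathbb{Z}: a\le k<b\}$. For index sets $I,J\subseteq\mathbb{Z}_{\ge 0}$, $U_{I,J}$ is the sub-matrix of $U$ with rows indexed by $I$ and columns indexed by $J$ (in increasing order). The empty ($n=0$) determinant is $1$. *)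

(* Defs.v *)
From mathcomp Require Import all_boot all_order all_algebra.

Set Implicit Arguments.
Unset Strict Implicit.
Unset Printing Implicit Defensive.

Import GRing.Theory.
Local Open Scope ring_scope.

Definition U (i j : nat) : int := if odd 'C(j, i) then 1 else 0.

(* Rows 0, ..., n - 1 and columns m, ..., m + n - 1 of U. *)
Definition Usub (m n : nat) : 'M[int]_n := \matrix_(i < n, j < n) U i (m + j).

(* Main.v *)
(** Since U = U \otimes [[1, 1], [0, 1]], separating even and odd indices turns
    the system with matrix U_m(n) into two systems of the same kind of about
    half the size.  By induction on n every such system with integer right-hand
    side has an integer solution, so U_m(n) is invertible over the integers. *)
Require Import Defs.
From mathcomp Require Import all_boot all_order all_algebra.
From mathcomp Require Import zify.

Set Implicit Arguments.
Unset Strict Implicit.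
Unset Printing Implicit Defensive.

Import GRing.Theory.
Local Open Scope ring_scope.

(** Pascal's rule applied twice doubles the middle term, so modulo 2 row 2j+2 arises from row 2j as
    in (1+x)^2 = 1+x^2. Both claims then follow by induction on [j]. *)
Lemma odd_bin_double j i :
  odd 'C(j.*2, i.*2) = odd 'C(j, i) /\ ~~ odd 'C(j.*2, i.*2.+1).
Proof.
elim: j i => [|j IHj] [|i]; rewrite ?doubleS ?double0 ?bin0 ?bin0n //.
  by rewrite bin1 /= odd_double.
have [IHi IHiS] := IHj i; have [IHi1 IHi1S] := IHj i.+1.
move: IHi IHiS IHi1 IHi1S; rewrite !doubleS !binS !oddD.
by do 4! case: (odd 'C(j.*2, _)) => //=; move=> <- _ <-.
Qed.

Lemma U_even_even i j : U i.*2 j.*2 = U i j.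
Proof. by rewrite /U (odd_bin_double j i).1. Qed.

Lemma U_odd_even i j : U i.*2.+1 j.*2 = 0.
Proof. by rewrite /U (negPf (odd_bin_double j i).2). Qed.

Lemma U_odd_odd i j : U i.*2.+1 j.*2.+1 = U i j.
Proof.
have [E O] := odd_bin_double j i.
by rewrite /U binS oddD E (negPf O).
Qed.

Lemma U_even_odd i j : U i.*2 j.*2.+1 = U i j.
Proof.
case: i => [|i]; first by rewrite /U !bin0.
have [E _] := odd_bin_double j i.+1; have [_ O] := odd_bin_double j i.
by rewrite /U doubleS binS oddD -doubleS E (negPf O) addbF.
Qed.

(** The bounds come from 2j >= m iff j >= [uphalf m], and 2j+1 >= m iff j >= [m./2]; likewise for
    [p]. *)
Lemma sum_parity (V : zmodType) (F : nat -> V) m p : (m <= p)%N ->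
  \sum_(m <= j < p) F j =
  \sum_(uphalf m <= j < uphalf p) F j.*2 + \sum_(m./2 <= j < p./2) F j.*2.+1.
Proof.
elim: p => [|p IHp]; first by rewrite leqn0 => /eqP ->; rewrite !big_geq ?addr0.
rewrite leq_eqVlt => /predU1P[<-|]; first by rewrite !big_geq ?addr0.
rewrite ltnS => le_mp; rewrite big_nat_recr //= IHp //.
have [Op|Ep] := boolP (odd p).
  have Dp : p = p./2.*2.+1 by rewrite -[LHS]odd_double_half Op.
  have up : uphalf p = p./2.+1 by rewrite uphalf_half Op.
  by rewrite up [X in _ = _ + X]big_nat_recr ?half_leq //= -Dp addrA.
have Dp : p = p./2.*2 by rewrite -[LHS]odd_double_half (negPf Ep).
have up : uphalf p = p./2 by rewrite uphalf_half (negPf Ep).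
have le_up : (uphalf m <= p./2)%N by rewrite -up uphalf_leq.
by rewrite up [X in _ = X + _]big_nat_recr //= -Dp addrAC.
Qed.

Definition interleave (T : Type) (xe xo : nat -> T) (j : nat) :=
  if odd j then xo j./2 else xe j./2.

Lemma interleave_even T (xe xo : nat -> T) j : interleave xe xo j.*2 = xe j.
Proof. by rewrite /interleave odd_double doubleK. Qed.

Lemma interleave_odd T (xe xo : nat -> T) j : interleave xe xo j.*2.+1 = xo j.
Proof. by rewrite /interleave /= odd_double /= uphalf_double. Qed.

Lemma sum_U_even xe xo i m p : (m <= p)%N ->
  \sum_(m <= j < p) U i.*2 j * interleave xe xo j =
  \sum_(uphalf m <= j < uphalf p) U i j * xe j +
  \sum_(m./2 <= j < p./2) U i j * xo j.
Proof.
move/sum_parity->; congr (_ + _); apply: eq_bigr => j _.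
  by rewrite U_even_even interleave_even.
by rewrite U_even_odd interleave_odd.
Qed.

(** Odd rows vanish at even columns, so they constrain [xo] alone: the split system is block
    triangular. *)
Lemma sum_U_odd xe xo i m p : (m <= p)%N ->
  \sum_(m <= j < p) U i.*2.+1 j * interleave xe xo j =
  \sum_(m./2 <= j < p./2) U i j * xo j.
Proof.
move/sum_parity->; rewrite big1 ?add0r => [|j _]; last first.
  by rewrite U_odd_even mul0r.
by apply: eq_bigr => j _; rewrite U_odd_odd interleave_odd.
Qed.

Lemma U_solvable n m (b : nat -> int) :
  exists x : nat -> int,
    forall i, (i < n)%N -> \sum_(m <= j < m + n) U i j * x j = b i.
Proof.
elim/ltn_ind: n m b => n IHn m b.
(* Size 1 has to be a base case since [uphalf 1 = 1]; row 0 of [U] is constantly 1. *)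
have [n_le1 | n_gt1] := leqP n 1.
  exists (fun=> b 0) => -[|i] lt_in; last by lia.
  have -> : n = 1 by lia.
  by rewrite addn1 big_nat1 /U bin0 mul1r.
have [/andP[On Om] | Hnm] := boolP (odd n && odd m).
  (* Here the even rows outnumber the even columns: they are solved for the
     sums xe j + xo j, together with the value of xo at the unpaired column. *)
  have [k Dn] : exists k, n = k.*2.+1 by exists n./2; lia.
  have [l Dm] : exists l, m = l.*2.+1 by exists m./2; lia.
  have lt_kn : (k < n)%N by lia.
  have lt_k1n : (k.+1 < n)%N by lia.
  have [y Hy] := IHn _ lt_k1n l (fun i => b i.*2).
  (* The unpaired column 2l+1 = m has value [y l]; moving its contribution to the right leaves k odd
     rows in k unknowns. *)
  have [z Hz] := IHn _ lt_kn l.+1 (fun i => b i.*2.+1 - U i l * y l).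
  pose xo j := if j == l then y l else z j.
  have xoE i : \sum_(l.+1 <= j < l.+1 + k) U i j * xo j =
               \sum_(l.+1 <= j < l.+1 + k) U i j * z j.
    by apply: eq_big_nat => j /andP[lt_lj _]; rewrite /xo gtn_eqF.
  have xol : xo l = y l by rewrite /xo eqxx.
  (* Subtracting [xo] restores xe + xo = y. The even entry at index l is irrelevant, as column 2l
     lies below m. *)
  exists (interleave (fun j => y j - xo j) xo) => i lt_in.
  have le_m : (m <= m + n)%N by lia.
  have Em : uphalf m = l.+1 by lia.
  have Om2 : m./2 = l by lia.
  have Emn : uphalf (m + n) = (l.+1 + k)%N by lia.
  have Omn : (m + n)./2 = (l.+1 + k)%N by lia.
  have lt_l : (l < l.+1 + k)%N by lia.
  have [i' [Di|Di]] : exists i', i = i'.*2 \/ i = i'.*2.+1 by exists i./2; lia.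
    rewrite Di sum_U_even // Em Om2 Emn Omn -Hy; last by lia.
    rewrite addnS -addSn [in RHS]big_ltn // [X in _ + X]big_ltn // xol.
    rewrite addrCA -big_split /=; congr (_ + _).
    by apply: eq_bigr => j _; rewrite -mulrDr subrK.
  rewrite Di sum_U_odd // Om2 Omn big_ltn // xol xoE Hz; last by lia.
  by rewrite addrC subrK.
have lt_kn : (n./2 < n)%N by lia.
have lt_un : (uphalf n < n)%N by lia.
(* Odd rows and odd columns now both number [n./2], so back substitution works: first [xo], then
   [xe]. *)
have [xo Ho] := IHn _ lt_kn m./2 (fun i => b i.*2.+1).
have [xe He] := IHn _ lt_un (uphalf m)
  (fun i => b i.*2 - \sum_(m./2 <= j < m./2 + n./2) U i j * xo j).
exists (interleave xe xo) => i lt_in.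
have le_m : (m <= m + n)%N by lia.
have Emn : uphalf (m + n) = (uphalf m + uphalf n)%N by lia.
have Omn : (m + n)./2 = (m./2 + n./2)%N by lia.
have [i' [Di|Di]] : exists i', i = i'.*2 \/ i = i'.*2.+1 by exists i./2; lia.
  by rewrite Di sum_U_even // Emn Omn He ?subrK //; lia.
by rewrite Di sum_U_odd // Omn Ho //; lia.
Qed.

(** Solving for each column of the identity assembles a right inverse, which suffices for a square
    matrix over a commutative ring. *)
Lemma unitmx_solvable (R : comUnitRingType) n (A : 'M[R]_n) :
  (forall b : 'cV_n, exists x : 'cV_n, A *m x = b) -> A \in unitmx.
Proof.
move=> solA.
have [x Hx] := fin_all_exists (fun j => solA (col j 1%:M)).
suff /mulmx1_unit[] : A *m (\matrix_(i, j) x j i 0) = 1%:M by [].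
apply/matrixP => i j; have /matrixP/(_ i 0) := Hx j.
by rewrite !mxE => <-; apply: eq_bigr => k _; rewrite mxE.
Qed.

Theorem theorem1 (n m : nat) : \det (Usub m n) = 1 \/ \det (Usub m n) = -1.
Proof.
suff: Usub m n \in unitmx.
  (* The determinant is a unit of [int], hence 1 or -1. *)
  by rewrite unitmxE => /pred2P.
apply: unitmx_solvable => b.
(* [insub] extends the vector [b] by 0 to all natural indices. *)
have [x Hx] := U_solvable n m (fun i => oapp (b^~ 0) 0 (insub i)).
exists (\col_j x (m + j)%N); apply/matrixP => i j; rewrite !mxE (ord1 j).
have := Hx i (ltn_ord i); rewrite valK /= => <-.
rewrite [(m + n)%N]addnC -{3}[m]add0n big_addn addnK big_mkord.
by apply: eq_bigr => k _; rewrite !mxE addnC.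
Qed.
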